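(* $\mathbf{MNS}\subseteq\mathbf{C_{=}P}$.
   Context: For a polynomial $p$, a polynomial-time computable predicate $R$ and input $x$, write $N(x)=|\{y : |y|=p(|x|)\wedge R(x,y)\}|$. A language $L$ is in $\mathbf{C_{=}P}$ if there exist $p,R$ such that for all $x$: $x\in L\iff N(x)=2^{p(|x|)-1}$. A language $L$ is in $\mathbf{MNS}$ if there exist $p,R$ such that for all $x$: $x\in L\iff N(x)=2^t-1$ for some $t\in\{1,2,3,\dots\}$. *)

(* Defs.v *)
From HB Require Import structures.
From mathcomp Require Import all_boot all_order all_algebra.

Set Implicit Arguments.
Unset Strict Implicit.
Unset Printing Implicit Defensive.

Import GRing.Theory.

Local Open Scope ring_scope.

Definition word := seq bool.
Definition language := word -> Prop.

(* Tape symbols: None is the blank, Some (inl b) the input bit b, and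
   Some (inr a) an auxiliary work symbol. *)
Definition sym (A : finType) : finType := option (bool + A)%type.

Inductive move := MoveL | MoveR | MoveN.

(* A two-way infinite tape (l, r): the head scans the first cell of r, and l
   lists the cells to its left, nearest first; cells beyond l or r are blank. *)
Definition tape (A : finType) := (seq (sym A) * seq (sym A))%type.

Definition tape_of_word (A : finType) (w : word) : tape A :=
  ([::], [seq Some (inl b) | b <- w]).

Definition tape_read (A : finType) (tp : tape A) : sym A := head None tp.2.

Definition tape_act (A : finType) (a : sym A * move) (tp : tape A) : tape A :=
  let: (l, r) := tp in
  let: (s, m) := a in
  match m with
  | MoveL => (behead l, head None l :: s :: behead r)
  | MoveR => (s :: l, behead r)
  | MoveN => (l, s :: behead r)
  end.

(* Deterministic multi-tape Turing machines with at least two tapes.  A state q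
   is halting, with answer b, when tm_output q = Some b. *)
Record tm := TM {
  tm_extra : nat;
  tm_aux : finType;
  tm_state : finType;
  tm_start : tm_state;
  tm_output : tm_state -> option bool;
  tm_delta : tm_state -> {ffun 'I_tm_extra.+2 -> sym tm_aux} ->
             tm_state * ('I_tm_extra.+2 -> sym tm_aux * move)
}.

Record config (M : tm) := Config {
  cfg_state : tm_state M;
  cfg_tapes : {ffun 'I_(tm_extra M).+2 -> tape (tm_aux M)}
}.

(* The arguments x and y are written on the first two tapes; the others are
   blank. *)
Definition tm_init (M : tm) (x y : word) : config M :=
  Config (tm_start M)
    [ffun i : 'I_(tm_extra M).+2 =>
       tape_of_word (tm_aux M)
         (if val i == 0%N then x else if val i == 1%N then y else [::])].

Definition tm_step (M : tm) (c : config M) : config M :=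
  if tm_output (cfg_state c) is Some _ then c else
  let: (q, act) :=
    tm_delta (cfg_state c) [ffun i => tape_read (cfg_tapes c i)] in
  Config q [ffun i => tape_act (act i) (cfg_tapes c i)].

(* Since halting configurations are fixed points, this says that on arguments
   x, y the machine halts within T (|x| + |y|) steps with answer R x y. *)
Definition tm_decides_in (M : tm) (T : nat -> nat) (R : word -> word -> bool) :=
  forall x y : word,
    tm_output (cfg_state (iter (T (size x + size y)%N) (@tm_step M)
                            (tm_init M x y))) = Some (R x y).

Definition polytime (R : word -> word -> bool) : Prop :=
  exists (M : tm) (q : {poly nat}), tm_decides_in M (fun n => q.[n]) R.

Definition witness_count (p : {poly nat}) (R : word -> word -> bool)
    (x : word) : nat :=
  #|[set y : (p.[size x]).-tuple bool | R x y]|.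

(* The power of 2 is taken in rat, so that it is 1/2 when p(|x|) = 0. *)
Definition CeqP (L : language) : Prop :=
  exists (p : {poly nat}) (R : word -> word -> bool),
    polytime R /\
    forall x : word,
      L x <-> (witness_count p R x)%:Q = 2%:Q ^ ((p.[size x])%:Z - 1).

Definition MNS (L : language) : Prop :=
  exists (p : {poly nat}) (R : word -> word -> bool),
    polytime R /\
    forall x : word,
      L x <-> exists t : nat, (0 < t)%N /\ witness_count p R x = (2 ^ t - 1)%N.

(* Main.v *)
(* Write N for the number of witnesses of x and m = p(|x|).  Since N <= 2^m, x lies in L
   iff the product over t = 1, ..., m+1 of the factors N - (2^t - 1) vanishes.  Each
   factor (times 2) is the sum of the signs of a block (al, be, v) with |v| = m+1:
   al = be = 0 contributes + or - according to whether v = w1 with R(x,w) or not;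
   al = be = 1 contributes - or + according to whether v is one of the 2^t - 1
   nonzero words supported on the first t positions; the two other cases contribute
   opposite constants.  A word y made of m+1 such blocks gets the product of
   their signs, so that these signs sum to the product of the factors, which
   vanishes iff exactly half of the words y are negative.

   To compute the sign of y, a machine recovers k = m+1 from |y| = k(k+2), then simulates
   the given machine for R once per block.  One extra tape counts the simulated
   steps; it bounds the cells in use, which lets the work tapes be erased
   between two simulations. *)

From mathcomp Require Import all_boot all_order all_algebra.
From mathcomp Require Import zify ring.
From Stdlib Require Import FunctionalExtensionality.
Require Import Defs.

Set Implicit Arguments.
Unset Strict Implicit.
Unset Printing Implicit Defensive.

Import GRing.Theory Num.Theory.

Local Open Scope nat_scope.

(** * Tapes as functions of the position relative to the head *)

Section FunctionalTapes.
Variable A : finType.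

(** List tapes that differ only by trailing blanks become the same function, so that an erased tape
    is equal to [blank]. *)
Definition ftape := int -> sym A.

Definition abs_tape (tp : tape A) : ftape := fun z =>
  match z with Posz n => nth None tp.2 n | Negz n => nth None tp.1 n end.

Definition put (s : sym A) (t : ftape) : ftape := fun z => if z == 0%R then s else t z.

Definition shift (i : int) (t : ftape) : ftape := fun z => t (z + i)%R.

Definition displacement (m : move) : int :=
  match m with MoveL => (-1)%R | MoveR => 1%R | MoveN => 0%R end.

Definition ftape_act (a : sym A * move) (t : ftape) : ftape :=
  shift (displacement a.2) (put a.1 t).

Lemma abs_tape_act a tp : abs_tape (tape_act a tp) = ftape_act a (abs_tape tp).
Proof.
case: tp a => [l r] [s m]; apply: functional_extensionality => z.
rewrite /ftape_act /shift /put.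
case: m; case: z => n; rewrite [displacement _]/=.
- case: n => [|[|n]] //.
  have -> : (Posz n.+2 + -1)%R = Posz n.+1 by lia.
  by rewrite /= nth_behead.
- have -> : (Negz n + -1)%R = Negz n.+1 by lia.
  by rewrite /= nth_behead.
- have -> : (Posz n + 1)%R = Posz n.+1 by lia.
  by rewrite /= nth_behead.
- case: n => [|n] //.
  have -> : (Negz n.+1 + 1)%R = Negz n by lia.
  by [].
- by rewrite addr0; case: n => [|n] //=; rewrite nth_behead.
- by rewrite addr0.
Qed.

Lemma abs_tape_read tp : abs_tape tp 0%R = tape_read tp.
Proof. by rewrite /= nth0. Qed.

Lemma put_id t : put (t 0%R) t = t.
Proof. by apply: functional_extensionality => z; rewrite /put; case: eqP => // ->. Qed.

Lemma shift0 t : shift 0%R t = t.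
Proof. by apply: functional_extensionality => z; rewrite /shift addr0. Qed.

Lemma shift_shift i j t : shift i (shift j t) = shift (i + j)%R t.
Proof. by apply: functional_extensionality => z; rewrite /shift addrA. Qed.

Lemma ftape_act_keep t : ftape_act (t 0%R, MoveN) t = t.
Proof. by rewrite /ftape_act /= put_id shift0. Qed.

Lemma ftape_act_move t m : ftape_act (t 0%R, m) t = shift (displacement m) t.
Proof. by rewrite /ftape_act /= put_id. Qed.

Definition blank : ftape := fun=> None.

(* The tape on which s occupies the cells 0, 1, ..., scanned at position i. *)
Definition seq_tape (s : seq (sym A)) (i : int) : ftape := fun z =>
  if (z + i)%R is Posz n then nth None s n else None.

Lemma shift_seq_tape s i j : shift j (seq_tape s i) = seq_tape s (j + i)%R.
Proof. by apply: functional_extensionality => z; rewrite /shift /seq_tape addrA. Qed.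

Lemma seq_tape_nil i : seq_tape [::] i = blank.
Proof.
apply: functional_extensionality => z; rewrite /seq_tape /blank.
by case: (z + i)%R => // n; rewrite nth_nil.
Qed.

Lemma seq_tape_read s (i : nat) : seq_tape s i%:Z 0%R = nth None s i.
Proof. by rewrite /seq_tape add0r. Qed.

Lemma put_seq_tape a s (i : nat) : put a (seq_tape s i%:Z) = seq_tape (set_nth None s i a) i%:Z.
Proof.
apply: functional_extensionality => z; rewrite /put /seq_tape.
case: eqP => [->|nz]; first by rewrite add0r nth_set_nth /= eqxx.
case E: (z + i)%R => [n|] //; rewrite nth_set_nth /=.
by case: eqP => // ni; case: nz; lia.
Qed.

Lemma put_rcons a s : put a (seq_tape s (size s)%:Z) = seq_tape (rcons s a) (size s)%:Z.
Proof.
rewrite put_seq_tape; congr seq_tape.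
by elim: s => //= x s ->.
Qed.

Lemma put_erase a s : put None (seq_tape (rcons s a) (size s)%:Z) = seq_tape s (size s)%:Z.
Proof.
rewrite put_seq_tape.
apply: functional_extensionality => z; rewrite /seq_tape.
case E: (z + size s)%R => [n|] //; rewrite nth_set_nth /= nth_rcons.
case: eqP => [->|/eqP nn]; first by rewrite nth_default.
by case: ltngtP nn => // h _; rewrite nth_default // ltnW.
Qed.

Lemma abs_tape_of_word w :
  abs_tape (tape_of_word A w) = seq_tape [seq Some (inl b) | b <- w] 0%R.
Proof.
apply: functional_extensionality => z; rewrite /seq_tape /= addr0.
by case: z => n //=; rewrite nth_nil.
Qed.

Definition supported (B : nat) (t : ftape) := forall z : int, B < `|z|%N -> t z = None.

(** The radius is measured from the head, so a move can increase it by one even when nothing is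
    written. *)
Lemma supported_act B a t : supported B t -> supported B.+1 (ftape_act a t).
Proof.
case: a => s m h z hz; rewrite /ftape_act /shift /put /=.
case: eqP => [e|_]; first by case: m e; rewrite /displacement; lia.
by apply: h; case: m; rewrite /displacement; lia.
Qed.

Lemma supported_leq B B' t : B <= B' -> supported B t -> supported B' t.
Proof. by move=> le h z hz; apply: h; apply: leq_ltn_trans hz. Qed.

Lemma supported_seq_tape s : supported (size s) (seq_tape s 0%R).
Proof.
move=> z hz; rewrite /seq_tape addr0; case: z hz => n // hn.
by rewrite nth_default //; exact: ltnW hn.
Qed.

Definition erase_right (t : ftape) : ftape := ftape_act (None, MoveR) t.

(** Each erasure moves the head one cell to the right, so the [c] erased cells end up at positions
    -c to -1. *)
Lemma iter_erase_right c t z :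
  iter c erase_right t z = if ((- (Posz c) <= z) && (z < 0))%R then None else t (z + c)%R.
Proof.
elim: c z => [|c IH] z; first by rewrite /= addr0 ifF //; lia.
rewrite iterS /erase_right /ftape_act /shift /put /=.
case: eqP => [e|ne]; first by rewrite ifT //; lia.
rewrite IH; have -> : ((z + 1 + c) = z + c.+1)%R by lia.
move/eqP: ne => ne; congr (if _ then _ else _).
by apply/andP/andP => -[h1 h2]; split; lia.
Qed.

(** A sweep of 2B+1 cells that starts B cells to the left of the old head covers the positions -B to
    B. *)
Lemma erase_supported B t : supported B t ->
  iter (B.*2).+1 erase_right (shift (- B%:Z)%R t) = blank.
Proof.
move=> h; apply: functional_extensionality => z; rewrite iter_erase_right /blank.
by case: ifP => // hz; rewrite /shift h //; lia.
Qed.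

End FunctionalTapes.

Arguments blank {A}.
Arguments seq_tape : simpl never.
Arguments abs_tape : simpl never.

(** * Structured programs and their compilation *)

Section Programs.
Variables (I : Type) (A Rg : finType).

Definition reads := I -> sym A.
Definition actions := I -> sym A * move.

Inductive cmd :=
  | Act of (Rg -> reads -> Rg * actions)
  | Seq of cmd & cmd
  | While of (Rg -> reads -> bool) & cmd.

Definition store := (Rg * (I -> ftape A))%type.

Definition store_reads (s : store) : reads := fun i => s.2 i 0%R.

Definition apply_actions (s : store) (ra : Rg * actions) : store :=
  (ra.1, fun i => ftape_act (ra.2 i) (s.2 i)).

(** Each evaluation of a loop test costs one step, because the compiled machine spends a transition
    on it; sequencing is free. *)
Inductive exec : cmd -> store -> nat -> store -> Prop :=
  | ExecAct f s : exec (Act f) s 1 (apply_actions s (f s.1 (store_reads s)))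
  | ExecSeq a b s1 n1 s2 n2 s3 :
      exec a s1 n1 s2 -> exec b s2 n2 s3 -> exec (Seq a b) s1 (n1 + n2) s3
  | ExecWhileStop t c s :
      t s.1 (store_reads s) = false -> exec (While t c) s 1 s
  | ExecWhileLoop (t : Rg -> reads -> bool) c s1 n1 s2 n2 s3 :
      t s1.1 (store_reads s1) -> exec c s1 n1 s2 -> exec (While t c) s2 n2 s3 ->
      exec (While t c) s1 (n1 + n2).+1 s3.

Definition runs c s s' B := exists2 n, n <= B & exec c s n s'.

Lemma runs_leq c s s' B B' : B <= B' -> runs c s s' B -> runs c s s' B'.
Proof. by move=> le [n hn e]; exists n => //; apply: leq_trans le. Qed.

Lemma runs_seq a b s1 s2 s3 B1 B2 :
  runs a s1 s2 B1 -> runs b s2 s3 B2 -> runs (Seq a b) s1 s3 (B1 + B2).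
Proof.
by move=> [n1 h1 e1] [n2 h2 e2]; exists (n1 + n2); [apply: leq_add | apply: ExecSeq e1 e2].
Qed.

(** The bound counts [n] rounds of test and body, plus the last test. An invariant, rather than a
    prescribed sequence of stores, serves loops whose intermediate stores are known only up to
    bounds. *)
Lemma runs_while_inv (t : Rg -> reads -> bool) c (Inv : nat -> store -> Prop) n b s :
  (forall i s1, i < n -> Inv i s1 -> t s1.1 (store_reads s1) /\
     exists2 s2, Inv i.+1 s2 & runs c s1 s2 b) ->
  (forall s1, Inv n s1 -> t s1.1 (store_reads s1) = false) ->
  Inv 0 s ->
  exists2 s', Inv n s' & runs (While t c) s s' (n * b.+1).+1.
Proof.
(* The starting index is generalized from 0 to any [i], for induction on the number [n - i] of
   remaining rounds. *)
move=> step stop; have -> : n * b.+1 = (n - 0) * b.+1 by rewrite subn0.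
have: 0 <= n by []. move: 0 s => i s.
have [j] := ubnP (n - i); elim: j i s => // j IH i s lt_j; rewrite leq_eqVlt.
case/predU1P => [->|lt_in] inv.
  exists s => //; exists 1 => //.
  by apply: ExecWhileStop; apply: stop.
have [ts [s2 inv2 [n2 le2 e2]]] := step _ _ lt_in inv.
have [||s3 inv3 [n3 le3 e3]] := IH i.+1 s2 _ _ inv2; [lia | by [] |].
exists s3 => //; exists (n2 + n3).+1; last exact: ExecWhileLoop ts e2 e3.
have -> : n - i = (n - i.+1).+1 by lia.
by rewrite mulSn; lia.
Qed.

Lemma runs_while (t : Rg -> reads -> bool) c (S : nat -> store) n b :
  (forall i, i < n -> t (S i).1 (store_reads (S i)) /\ runs c (S i) (S i.+1) b) ->
  t (S n).1 (store_reads (S n)) = false ->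
  runs (While t c) (S 0) (S n) (n * b.+1).+1.
Proof.
move=> step stop.
have [||//|s' -> //] := @runs_while_inv t c (fun i s => s = S i) n b (S 0).
- by move=> i s1 lt ->; have [h1 h2] := step i lt; split => //; exists (S i.+1).
- by move=> s1 ->.
Qed.

Fixpoint label (c : cmd) : finType :=
  match c with
  | Act _ => unit
  | Seq a b => (label a + label b)%type
  | While _ a => option (label a)
  end.

Fixpoint entry (c : cmd) : label c :=
  match c with
  | Act _ => tt
  | Seq a b => inl (entry a)
  | While _ _ => None
  end.

Definition keep_all (rd : reads) : actions := fun i => (rd i, MoveN).

(* The label None of a loop is its test; the exit of its body leads back there,
   so the optional successor in the body is already a label of the loop. *)
Fixpoint next (c : cmd) : label c -> Rg -> reads -> option (label c) * (Rg * actions) :=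
  match c with
  | Act f => fun _ r rd => (None, f r rd)
  | Seq a b => fun l r rd =>
      match l with
      | inl l => let: (o, ra) := next l r rd in
                 (Some (if o is Some l' then inl l' else inr (entry b)), ra)
      | inr l => let: (o, ra) := next l r rd in (omap inr o, ra)
      end
  | While t a => fun l r rd =>
      match l with
      | None => (if t r rd then Some (Some (entry a)) else None, (r, keep_all rd))
      | Some l => let: (o, ra) := next l r rd in (Some o, ra)
      end
  end.

Definition prog_step (c : cmd) (st : option (label c) * store) :=
  match st with
  | (Some l, s) => let: (o, ra) := next l s.1 (store_reads s) in (o, apply_actions s ra)
  | (None, s) => (None, s)
  end.

(** The program is left at step [n] exactly, not earlier; this exactness is what lets runs of
    subprograms be concatenated. *)
Fixpoint exits (c : cmd) (l : label c) (s : store) (n : nat) (s' : store) : Prop :=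
  if n is n.+1 then
    let: (o, ra) := next l s.1 (store_reads s) in
    if o is Some l' then exits l' (apply_actions s ra) n s'
    else n = 0 /\ apply_actions s ra = s'
  else False.

Lemma apply_keep_all s : apply_actions s (s.1, keep_all (store_reads s)) = s.
Proof.
case: s => r T; congr pair; apply: functional_extensionality => i.
exact: ftape_act_keep.
Qed.

Lemma exits_seqr a b (l : label b) s n s' :
  exits l s n s' -> @exits (Seq a b) (inr l) s n s'.
Proof. by elim: n l s => // n IH l s /=; case: (next _ _ _) => [[l'|] ra] //=; exact: IH. Qed.

(** The transition that leaves [a] already lands on the entry of [b], so the times add up without
    overhead. *)
Lemma exits_seql a b (l : label a) s n s1 n' s' :
  exits l s n s1 -> exits (entry b) s1 n' s' ->
  @exits (Seq a b) (inl l) s (n + n') s'.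
Proof.
elim: n l s => // n IH l s /=; case: (next _ _ _) => [[l'|] ra] h e.
  exact: IH.
by case: h => -> ->; apply: exits_seqr.
Qed.

Lemma exits_body t a (l : label a) s n s1 n' s' :
  exits l s n s1 -> @exits (While t a) None s1 n' s' ->
  @exits (While t a) (Some l) s (n + n') s'.
Proof.
elim: n l s => // n IH l s /=; case: (next _ _ _) => [[l'|] ra] h e.
  exact: IH.
by case: h => -> ->.
Qed.

Lemma exec_exits c s n s' : exec c s n s' -> exits (entry c) s n s'.
Proof.
elim=> {c s n s'} [f s //|a b s1 n1 s2 n2 s3 _ h1 _ h2|t c s ts|t c s1 n1 s2 n2 s3 ts _ h1 _ h2].
- exact: exits_seql h1 h2.
- by rewrite /= ts; split=> //; apply: apply_keep_all.
- rewrite [entry _]/= [exits _ _ _ _]/= ts apply_keep_all.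
  exact: exits_body h1 h2.
Qed.

Lemma exits_iter c (l : label c) s n s' :
  exits l s n s' -> iter n (@prog_step c) (Some l, s) = (None, s').
Proof.
elim: n l s => // n IH l s h; rewrite iterSr; move: h => /=.
case: (next _ _ _) => [[l'|] ra]; first exact: IH.
by case=> -> ->.
Qed.

End Programs.

(** * Compilation of a program into a Turing machine *)

Section Compilation.
Variables (I : Type) (A Rg : finType) (e : nat).
Variables (enc : I -> 'I_e.+2) (dec : 'I_e.+2 -> I).
Hypothesis encK : cancel enc dec.
Variables (r0 : Rg) (c : cmd I A Rg) (out : Rg -> bool).

Definition compile : tm :=
  @TM e A (option (label c) * Rg)%type (Some (entry c), r0)
    (fun q => if q.1 is None then Some (out q.2) else None)
    (fun q rd =>
       match q with
       | (Some l, r) =>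
         let: (o, ra) := next l r (fun i => rd (enc i)) in ((o, ra.1), fun j => ra.2 (dec j))
       | (None, r) => ((None, r), fun j => (rd j, MoveN))
       end).

Definition abs_config (cf : config compile) : option (label c) * store I A Rg :=
  ((cfg_state cf).1, ((cfg_state cf).2, fun i => abs_tape (cfg_tapes cf (enc i)))).

Lemma abs_config_step cf : abs_config (tm_step cf) = prog_step (abs_config cf).
Proof.
case: cf => [[[l|] r] T] //; rewrite /tm_step /abs_config /=.
have -> : (fun i => [ffun i0 => tape_read (T i0)] (enc i)) =
          store_reads (r, fun i => abs_tape (T (enc i))).
  by apply: functional_extensionality => i; rewrite ffunE -abs_tape_read.
case: (next _ _ _) => o ra /=; congr (_, (_, _)).
apply: functional_extensionality => i.
by rewrite ffunE abs_tape_act encK.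
Qed.

Lemma compile_decides (R : word -> word -> bool) (T : nat -> nat) :
  (forall x y, exists2 s,
     runs c (r0, fun i => abs_tape (tape_of_word A
                  (if val (enc i) == 0 then x else if val (enc i) == 1 then y else [::])))
          s (T (size x + size y)) & out s.1 = R x y) ->
  tm_decides_in compile T R.
Proof.
move=> h x y; have [s [n le_n ex] os] := h x y.
set ini := tm_init compile x y.
have abs_iter m : abs_config (iter m (@tm_step compile) ini) =
                  iter m (@prog_step _ _ _ c) (abs_config ini).
  by elim: m => //= m <-; rewrite abs_config_step.
have := abs_iter (T (size x + size y)).
rewrite -[in RHS](subnK le_n) iterD.
have -> : abs_config ini = (Some (entry c), (r0, fun i => abs_tape (tape_of_word A
     (if val (enc i) == 0 then x else if val (enc i) == 1 then y else [::])))).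
  by congr (_, (_, _)); apply: functional_extensionality => i; rewrite ffunE.
rewrite (exits_iter (exec_exits ex)).
(* The exit is a fixed point, so the steps left before the time bound change nothing. *)
have -> m : iter m (@prog_step _ _ _ c) (None, s) = (None, s) by elim: m => //= m ->.

move: (iter _ _ ini) => cf; case: cf => [[o r] Tt] [/= -> hs].
by rewrite /= -os -hs.
Qed.

End Compilation.

(** * The program computing the sign of a word *)

(** Blocks are numbered from 0 and exponents from 1: block [i] deals with t = i+1, and 2^t - 1 words
    of a given length at least t qualify. *)
Definition nonzero_prefix (i : nat) (v : word) := has id v && ~~ has id (drop i.+1 v).

(** The value [true] stands for the sign -, so that exclusive or multiplies signs. *)
Definition negative_block (R : word -> word -> bool) (x : word) (i : nat) (s : word) : bool :=
  let v := drop 2 s in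
  if nth false s 0 then (if nth false s 1 then nonzero_prefix i v else true)
  else if nth false s 1 then false
  else ~~ (last false v && R x (take (size v).-1 v)).

(** Only lengths k(k+2) matter for the count; padding gives the predicate a meaning, easy to
    compute, on all other words. *)
Definition pad (j : nat) (y : word) : word := y ++ nseq (j - size y) false.

Lemma block_count_exists L : exists k, L <= k * k.+2.
Proof. by exists L; rewrite leq_pmulr. Qed.

Definition block_count (L : nat) : nat := ex_minn (block_count_exists L).

Definition product_predicate (R : word -> word -> bool) (x y : word) : bool :=
  let k := block_count (size y) in
  \big[addb/false]_(0 <= i < k)
     negative_block R x i (take k.+2 (drop (i * k.+2) (pad (k * k.+2) y))).

Section Machine.
Variable M : tm.

Let A := tm_aux M.
Let K := (tm_extra M).+2.

(** [Xt] and [Yt] hold the arguments, [Ct] has one cell per block, [Dt] is the clock that bounds the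
    cells in use, and the [Mt j] are the tapes of the simulated machine. *)
Inductive tape_name := Xt | Yt | Ct | Dt | Mt of 'I_K.

(* The control state of M, then: the sign accumulated so far; the two selector
   bits of the current block; the last bit of its body v; whether v has a 1;
   whether v has a 1 beyond the marked cells; whether a cell was just marked. *)
Definition reg : finType :=
  (tm_state M * (bool * bool * bool * bool * bool * bool * bool))%type.

Let cmd := cmd tape_name A reg.
Let store := store tape_name A reg.
Let reads := reads tape_name A.
Let act := (sym A * move)%type.

Definition acts (ax ay ac ad : act) (am : 'I_K -> act) : actions tape_name A :=
  fun i => match i with Xt => ax | Yt => ay | Ct => ac | Dt => ad | Mt j => am j end.

Definition st (r : reg) (tx ty tc td : ftape A) (tm : 'I_K -> ftape A) : store :=
  (r, fun i => match i with Xt => tx | Yt => ty | Ct => tc | Dt => td | Mt j => tm j end).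

Lemma runs_act f r tx ty tc td tm r' ax ay ac ad am tx' ty' tc' td' tm' :
  f r (store_reads (st r tx ty tc td tm)) = (r', acts ax ay ac ad am) ->
  ftape_act ax tx = tx' -> ftape_act ay ty = ty' -> ftape_act ac tc = tc' ->
  ftape_act ad td = td' -> (forall j, ftape_act (am j) (tm j) = tm' j) ->
  runs (Act f) (st r tx ty tc td tm) (st r' tx' ty' tc' td' tm') 1.
Proof.
move=> ef ex ey ec ed em; exists 1 => //.
have <- : apply_actions (st r tx ty tc td tm) (f r (store_reads (st r tx ty tc td tm)))
          = st r' tx' ty' tc' td' tm'.
  rewrite ef; congr pair; apply: functional_extensionality => -[] //=.
exact: ExecAct.
Qed.

Definition keep (rd : reads) (i : tape_name) : act := (rd i, MoveN).
Definition keepM (rd : reads) (j : 'I_K) : act := keep rd (Mt j).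
Definition scanning (i : tape_name) (r : reg) (rd : reads) : bool := rd i.

Definition letter (b : bool) : sym A := Some (inl b).
Definition bit_of (s : sym A) : bool := if s is Some (inl b) then b else false.
Definition letters (w : word) : seq (sym A) := [seq letter b | b <- w].

Lemma nth_letters w i : i < size w -> nth None (letters w) i = letter (nth false w i).
Proof. by move=> lt; rewrite (nth_map false). Qed.

Lemma size_letters w : size (letters w) = size w.
Proof. exact: size_map. Qed.

Lemma letters_take_nth w i : i < size w ->
  letters (take i.+1 w) = rcons (letters (take i w)) (letter (nth false w i)).
Proof. by move=> lt; rewrite (take_nth false) // /letters map_rcons. Qed.

Lemma nth_letters_default w i : size w <= i -> nth None (letters w) i = None.
Proof. by move=> le; rewrite nth_default // size_letters. Qed.

Lemma keep_tape (t : ftape A) : ftape_act (t 0%R, MoveN) t = t.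
Proof. exact: ftape_act_keep. Qed.

Lemma move_seq s (i j : int) m : (displacement m + i = j)%R ->
  ftape_act (seq_tape s i 0%R, m) (seq_tape s i) = seq_tape s j :> ftape A.
Proof. by move=> <-; rewrite ftape_act_move shift_seq_tape. Qed.

Lemma append_seq (s s' : seq (sym A)) (a : sym A) (i : nat) : i = size s -> s' = rcons s a ->
  ftape_act (a, MoveR) (seq_tape s i) = seq_tape s' i.+1.
Proof.
move=> -> ->; rewrite /ftape_act /= put_rcons shift_seq_tape.
by congr seq_tape; lia.
Qed.

Lemma append_letter (w : word) i : i < size w ->
  ftape_act (letter (nth false w i), MoveR) (seq_tape (letters (take i w)) i) =
  seq_tape (letters (take i.+1 w)) i.+1.
Proof.
move=> lt; apply: append_seq; last exact: letters_take_nth.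
by rewrite size_letters size_takel // ltnW.
Qed.

Lemma append_counter (a : sym A) (d : nat) :
  ftape_act (a, MoveR) (seq_tape (nseq d a) d) = seq_tape (nseq d.+1 a) d.+1.
Proof. by apply: append_seq; rewrite ?size_nseq // -cats1 -[in RHS](nseqD d 1) addn1. Qed.

Definition consume (rd : reads) : act :=
  (if rd Yt is None then letter false else rd Yt, MoveR).

(** The Y tape once [j] cells are consumed: [pad j y] is [y] while [j] is at most its length, and
    then grows along with the head. *)
Definition padded (y : word) (j : nat) : ftape A := seq_tape (letters (pad j y)) j.

Lemma consume_padded y j r tx tc td tm :
  ftape_act (consume (store_reads (st r tx (padded y j) tc td tm))) (padded y j) = padded y j.+1.
Proof.
rewrite /consume /store_reads /=.
have -> : padded y j 0%R = nth None (letters (pad j y)) j by rewrite /padded seq_tape_read.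
case: (ltnP j (size y)) => h.
  have e l : l <= size y -> pad l y = y by rewrite /pad => le; rewrite (eqP le) cats0.
  have -> : match nth None (letters (pad j y)) j with Some _ => nth None (letters (pad j y)) j
            | None => letter false end = padded y j 0%R.
    by rewrite /padded seq_tape_read (e _ (ltnW h)) nth_letters.
  rewrite /padded (e _ (ltnW h)) (e _ h); apply: move_seq => /=; lia.
have sz : size (pad j y) = j by rewrite size_cat size_nseq; lia.
rewrite nth_letters_default ?sz //; apply: append_seq; first by rewrite size_letters sz.
rewrite /letters -map_rcons /pad subSn // -cats1 -catA; congr (map _ (_ ++ _)).
by rewrite -[[:: false]]/(nseq 1 false) -nseqD addn1.
Qed.

Local Ltac act_step := apply: runs_act;
  [reflexivity | try exact: keep_tape | try exact: keep_tape | try exact: keep_tape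
  | try exact: keep_tape | try by move=> ?; exact: keep_tape].

(** * Recovering the number of blocks *)

Definition growC : cmd :=
  Seq (While (scanning Ct) (Act (fun r rd =>
         (r, acts (keep rd Xt) (consume rd) (rd Ct, MoveR) (keep rd Dt) (keepM rd)))))
 (Seq (Act (fun r rd =>
         (r, acts (keep rd Xt) (consume rd) (letter false, MoveN) (keep rd Dt) (keepM rd))))
 (Seq (While (scanning Ct) (Act (fun r rd =>
         (r, acts (keep rd Xt) (consume rd) (rd Ct, MoveL) (keep rd Dt) (keepM rd)))))
      (Act (fun r rd =>
         (r, acts (keep rd Xt) (consume rd) (rd Ct, MoveR) (keep rd Dt) (keepM rd)))))).

(* One round visits the C tape to and fro, consuming one cell of Y per step: that
   makes 2j+3 = (j+1)(j+3) - j(j+2) cells when C has j letters. *)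
Lemma growC_runs y j r tx td tm :
  runs growC (st r tx (padded y (j * j.+2)) (seq_tape (nseq j (letter false)) 0%R) td tm)
       (st r tx (padded y (j.+1 * j.+3)) (seq_tape (nseq j.+1 (letter false)) 0%R) td tm)
       (4 * j + 6).
Proof.
set a := j * j.+2.
(* [S1] follows the way out along C, [S2] the way back from the new cell [j] to position -1. *)
pose S1 i := st r tx (padded y (a + i)) (seq_tape (nseq j (letter false)) i) td tm.
pose S2 (i : nat) := st r tx (padded y (a + j.+1 + i))
                        (seq_tape (nseq j.+1 (letter false)) (j%:Z - i%:Z)%R) td tm.
have L1 : runs (While (scanning Ct) (Act (fun r rd =>
         (r, acts (keep rd Xt) (consume rd) (rd Ct, MoveR) (keep rd Dt) (keepM rd)))))
         (S1 0) (S1 j) (j * 2).+1.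
  apply: runs_while => [i lt|]; last by rewrite /scanning /store_reads /= seq_tape_read nth_nseq ltnn.
  split; first by rewrite /scanning /store_reads /= seq_tape_read nth_nseq lt.
  rewrite /S1 addnS; act_step; first exact: consume_padded.
  by apply: move_seq => /=; lia.
have L2 : runs (While (scanning Ct) (Act (fun r rd =>
         (r, acts (keep rd Xt) (consume rd) (rd Ct, MoveL) (keep rd Dt) (keepM rd)))))
         (S2 0) (S2 j.+1) (j.+1 * 2).+1.
  apply: runs_while => [i lt|]; last first.
    by rewrite /scanning /store_reads /=; have -> : (j%:Z - j.+1%:Z = -1)%R by lia.
  split.
    rewrite -[scanning _ _ _]/(isSome (seq_tape _ _ _)).
    have -> : (j%:Z - i%:Z = (j - i)%N%:Z)%R by lia.
    by rewrite seq_tape_read nth_nseq ltnS leq_subr.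
  rewrite /S2 (addnS (a + j.+1)); act_step; first exact: consume_padded.
  by apply: move_seq => /=; lia.
have -> : st r tx (padded y a) (seq_tape (nseq j (letter false)) 0%R) td tm = S1 0.
  by rewrite /S1 addn0.
apply: (@runs_leq _ _ _ _ _ _ ((j * 2).+1 + (1 + ((j.+1 * 2).+1 + 1)))); first by lia.
apply: (runs_seq L1); apply: (runs_seq _ (runs_seq L2 _)).
  rewrite /S1 /S2 addn0 addnS; act_step; first exact: consume_padded.
  rewrite /ftape_act shift0 -[X in seq_tape _ X%:Z](size_nseq j (letter false)) put_rcons.
  by rewrite size_nseq -cats1 -[in LHS](nseqD j 1) addn1; congr seq_tape; lia.
rewrite /S2; have -> : j.+1 * j.+3 = (a + j.+1 + j.+1).+1 by rewrite /a; lia.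
act_step; first exact: consume_padded.
by apply: move_seq => /=; lia.
Qed.

Definition only (i : tape_name) (a : act) (rd : reads) : actions tape_name A :=
  acts (if i is Xt then a else keep rd Xt) (if i is Yt then a else keep rd Yt)
       (if i is Ct then a else keep rd Ct) (if i is Dt then a else keep rd Dt) (keepM rd).

(** After [j] rounds the head of Y is at cell j(j+2), which is blank iff [y] is exhausted. The first
    loop therefore stops at the least suitable [j], which is [block_count]; the rest rewinds Y. *)
Definition measure : cmd :=
  Seq (While (scanning Yt) growC)
 (Seq (Act (fun r rd => (r, only Yt (rd Yt, MoveL) rd)))
 (Seq (While (scanning Yt) (Act (fun r rd => (r, only Yt (rd Yt, MoveL) rd))))
      (Act (fun r rd => (r, only Yt (rd Yt, MoveR) rd))))).

Lemma block_countP L (k := block_count L) : L <= k * k.+2 /\ forall j, j < k -> j * j.+2 < L.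
Proof.
rewrite /k /block_count; case: ex_minnP => m le min; split=> // j lt.
by rewrite ltnNge; apply: contraL lt => /min; rewrite -leqNgt.
Qed.

Lemma size_pad y j : size y <= j -> size (pad j y) = j.
Proof. by move=> le; rewrite size_cat size_nseq subnKC. Qed.

Lemma measure_runs y r tx td tm (k := block_count (size y)) :
  runs measure (st r tx (seq_tape (letters y) 0%R) blank td tm)
    (st r tx (seq_tape (letters (pad (k * k.+2) y)) 0%R)
        (seq_tape (nseq k (letter false)) 0%R) td tm)
    (k * (4 * k + 7) + 2 * (k * k.+2) + 4).
Proof.
have [le min] := block_countP (size y); rewrite -/k in le min.
set P := k * k.+2; set ys := pad P y; have sz : size ys = P by rewrite size_pad.
pose S1 j := st r tx (padded y (j * j.+2)) (seq_tape (nseq j (letter false)) 0%R) td tm.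
have L1 : runs (While (scanning Yt) growC) (S1 0) (S1 k) (k * (4 * k + 6).+1).+1.
  apply: runs_while => [j lt|]; last first.
    by rewrite -[scanning _ _ _]/(isSome (padded _ _ _)) /padded seq_tape_read
               nth_letters_default // size_pad.
  split; last by apply: runs_leq (growC_runs y j r tx td tm); lia.
  rewrite -[scanning _ _ _]/(isSome (padded _ _ _)) /padded seq_tape_read nth_letters //.
  by apply: leq_trans (min _ lt) _; rewrite size_cat leq_addr.
(* Positions are integers: if [P] is 0, rewinding starts at -1 and its loop is empty. *)
pose S2 i := st r tx (seq_tape (letters ys) (P%:Z - 1 - i%:Z)%R)
                (seq_tape (nseq k (letter false)) 0%R) td tm.
have L2 : runs (While (scanning Yt) (Act (fun r rd => (r, only Yt (rd Yt, MoveL) rd))))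
               (S2 0) (S2 P) (P * 2).+1.
  apply: runs_while => [i lt|]; rewrite -[scanning _ _ _]/(isSome (seq_tape _ _ _)); last first.
    by have -> : (P%:Z - 1 - P%:Z = -1)%R by lia.
  split.
    have -> : (P%:Z - 1 - i%:Z = (P - 1 - i)%N%:Z)%R by lia.
    by rewrite seq_tape_read nth_letters //; lia.
  by act_step; apply: move_seq => /=; lia.
have -> : st r tx (seq_tape (letters y) 0%R) blank td tm = S1 0.
  by rewrite /S1 seq_tape_nil /padded /pad sub0n cats0.
apply: (@runs_leq _ _ _ _ _ _ ((k * (4 * k + 6).+1).+1 + (1 + ((P * 2).+1 + 1)))); first by lia.
apply: (runs_seq L1); apply: (runs_seq _ (runs_seq L2 _)).
  by act_step; apply: move_seq => /=; lia.
by act_step; apply: move_seq => /=; lia.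
Qed.

(** * Loading a block and the input *)

Definition two_tapes (t0 t1 : ftape A) : 'I_K -> ftape A := fun j =>
  if val j == 0 then t0 else if val j == 1 then t1 else blank.

Definition actM (f0 f1 : sym A -> act) (rd : reads) : 'I_K -> act := fun j =>
  if val j == 0 then f0 (rd (Mt j)) else if val j == 1 then f1 (rd (Mt j)) else keepM rd j.

Definition go (m : move) (s : sym A) : act := (s, m).

Lemma actM_two_tapes f0 f1 r tx ty tc td t0 t1 t0' t1' :
  ftape_act (f0 (t0 0%R)) t0 = t0' -> ftape_act (f1 (t1 0%R)) t1 = t1' ->
  forall j, ftape_act (actM f0 f1 (store_reads (st r tx ty tc td (two_tapes t0 t1))) j)
                      (two_tapes t0 t1 j) = two_tapes t0' t1' j.
Proof.
move=> e0 e1 j; rewrite /actM /two_tapes /store_reads /keepM /keep /=.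
by case: eqP => // _; case: eqP => // _; rewrite ftape_act_keep.
Qed.

(** Content of the C tape during block [i]: its length [k] delimits v, and its marked cells give the
    block index in unary. *)
Definition marks (k i : nat) : seq (sym A) := mkseq (fun l => letter (l < i)) k.

Definition second : 'I_K := lift ord0 ord0.

Definition read_al : cmd := Act (fun r rd =>
  let: (q, (acc, al, be, ga, z1, z2, se)) := r in
  ((q, (acc, bit_of (rd Yt), be, ga, z1, z2, se)), only Yt (rd Yt, MoveR) rd)).

Definition read_be : cmd := Act (fun r rd =>
  let: (q, (acc, al, be, ga, z1, z2, se)) := r in
  ((q, (acc, al, bit_of (rd Yt), ga, z1, z2, se)), only Yt (rd Yt, MoveR) rd)).

(** The flag [se] is raised at the first unmarked cell, number [i], which gets marked for the next
    block. From cell i+1 on it is set, so [z2] detects the ones of v beyond the first i+1 positions.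
    Each copied letter also advances the clock. *)
Definition copy_v : cmd := Act (fun r rd =>
  let: (q, (acc, al, be, ga, z1, z2, se)) := r in
  let: b := bit_of (rd Yt) in
  let: marked := bit_of (rd Ct) in
  ((q, (acc, al, be, ga, z1 || b, z2 || (b && se), se || ~~ marked)),
   acts (keep rd Xt) (rd Yt, MoveR) (letter (marked || ~~ se), MoveR) (letter false, MoveR)
        (actM (go MoveN) (fun=> (letter b, MoveR)) rd))).

Definition move_CM (m : move) : cmd := Act (fun r rd =>
  (r, acts (keep rd Xt) (keep rd Yt) (rd Ct, m) (keep rd Dt) (actM (go MoveN) (go m) rd))).

(** Erasing the last bit of v while reading it leaves w, the candidate witness, on the second tape
    of [M]. *)
Definition read_ga : cmd := Act (fun r rd =>
  let: (q, (acc, al, be, ga, z1, z2, se)) := r in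
  ((q, (acc, al, be, bit_of (rd (Mt second)), z1, z2, se)),
   acts (keep rd Xt) (keep rd Yt) (rd Ct, MoveL) (keep rd Dt)
        (actM (go MoveN) (fun=> (None, MoveL)) rd))).

Definition load_block : cmd :=
  Seq read_al (Seq read_be (Seq (While (scanning Ct) copy_v)
  (Seq (move_CM MoveL) (Seq read_ga (Seq (While (scanning Ct) (move_CM MoveL)) (move_CM MoveR)))))).

Lemma copy_v_runs q acc al be ga tx k i ys off d t0 j (v := take k (drop off ys)) :
  j < k -> off + k <= size ys ->
  runs copy_v
    (st (q, (acc, al, be, ga, has id (take j v), has id (drop i.+1 (take j v)), i < j))
        tx (seq_tape (letters ys) (off + j)%N) (seq_tape (marks k (i + (i < j))) j)
        (seq_tape (nseq (d + j) (letter false)) (d + j)%N)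
        (two_tapes t0 (seq_tape (letters (take j v)) j)))
    (st (q, (acc, al, be, ga, has id (take j.+1 v), has id (drop i.+1 (take j.+1 v)), i < j.+1))
        tx (seq_tape (letters ys) (off + j.+1)%N) (seq_tape (marks k (i + (i < j.+1))) j.+1)
        (seq_tape (nseq (d + j.+1) (letter false)) (d + j.+1)%N)
        (two_tapes t0 (seq_tape (letters (take j.+1 v)) j.+1))) 1.
Proof.
move=> ltj le.
have szv : size v = k by rewrite size_takel // size_drop; lia.
have ey : seq_tape (letters ys) (off + j)%N 0%R = letter (nth false v j).
  by rewrite seq_tape_read nth_letters ?nth_take ?nth_drop //; lia.
(* A mark added at cell [i] lies strictly to the left of cell [j], which still shows its old
   value. *)
have ec : seq_tape (marks k (i + (i < j))) j 0%R = letter (j < i).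
  by rewrite seq_tape_read nth_mkseq //; congr letter; lia.
have szt : size (take j v) = j by rewrite size_takel // szv ltnW.
have z1E : has id (take j.+1 v) = has id (take j v) || nth false v j.
  by rewrite (take_nth false) ?szv // has_rcons orbC.
have z2E : has id (drop i.+1 (take j.+1 v)) =
           has id (drop i.+1 (take j v)) || nth false v j && (i < j).
  rewrite (take_nth false) ?szv //; case: (ltnP i j) => h.
    by rewrite drop_rcons ?szt // has_rcons andbT orbC.
  by rewrite !drop_oversize ?size_rcons ?szt ?andbF // leqW.
have seE : (i < j.+1) = (i < j) || ~~ (j < i) by rewrite -leqNgt orb_idl // => /ltnW.
apply: runs_act.
- rewrite z1E z2E seE -[j < i]/(bit_of (letter (j < i)))
    -[nth false v j]/(bit_of (letter (nth false v j))) -ec -ey.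
  reflexivity.
- exact: keep_tape.
- by apply: move_seq => /=; lia.
- rewrite [store_reads _ _]/= ec /ftape_act put_seq_tape shift_seq_tape /=.
  have -> : (1 + j%:Z = j.+1%:Z)%R by lia.
  congr seq_tape; apply: (@eq_from_nth _ None).
    by rewrite size_set_nth !size_mkseq (maxn_idPr _).
  move=> l; rewrite size_set_nth size_mkseq (maxn_idPr _) // => lt.
  rewrite nth_set_nth /= !nth_mkseq //; case: eqP => [->|/eqP ne]; congr letter; lia.
- by rewrite addnS append_counter.
- apply: actM_two_tapes; first exact: keep_tape.
  by rewrite [store_reads _ _]/= ey; apply: append_letter; rewrite szv.
Qed.

Lemma load_block_runs q acc tx k i ys off d (v := take k (drop off.+2 ys)) :
  i < k -> off + k.+2 <= size ys ->
  runs load_block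
    (st (q, (acc, false, false, false, false, false, false))
        tx (seq_tape (letters ys) off) (seq_tape (marks k i) 0%R)
        (seq_tape (nseq d (letter false)) d) (two_tapes blank blank))
    (st (q, (acc, nth false ys off, nth false ys off.+1, last false v,
             has id v, has id (drop i.+1 v), true))
        tx (seq_tape (letters ys) (off + k.+2)%N) (seq_tape (marks k i.+1) 0%R)
        (seq_tape (nseq (d + k) (letter false)) (d + k)%N)
        (two_tapes blank (seq_tape (letters (take k.-1 v)) 0%R)))
    (4 * k + 5).
Proof.
move=> lt le.
have szv : size v = k by rewrite size_takel // size_drop; lia.
have k_gt0 : 0 < k by lia.
have wga : v = rcons (take k.-1 v) (last false v).
  by rewrite -nth_last szv -take_nth ?szv ?prednK // take_oversize ?szv.
have szw : size (take k.-1 v) = k.-1 by rewrite size_takel // szv leq_pred.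
set al := nth false ys off; set be := nth false ys off.+1.
pose S1 j := st (q, (acc, al, be, false, has id (take j v), has id (drop i.+1 (take j v)), i < j))
        tx (seq_tape (letters ys) (off.+2 + j)%N) (seq_tape (marks k (i + (i < j))) j)
        (seq_tape (nseq (d + j) (letter false)) (d + j)%N)
        (two_tapes blank (seq_tape (letters (take j v)) j)).
have L1 : runs (While (scanning Ct) copy_v) (S1 0) (S1 k) (k * 2).+1.
  apply: runs_while => [j ltj|]; rewrite -[scanning _ _ _]/(isSome (seq_tape _ _ _)) seq_tape_read.
    split; first by rewrite nth_mkseq.
    by apply: copy_v_runs => //; lia.
  by rewrite nth_default // size_mkseq.
(* Rewinding starts at k-2: one move left reaches the last letter, and erasing it makes another. *)
pose S2 j := st (q, (acc, al, be, last false v, has id v, has id (drop i.+1 v), true))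
        tx (seq_tape (letters ys) (off + k.+2)%N) (seq_tape (marks k i.+1) (k%:Z - 2 - j%:Z)%R)
        (seq_tape (nseq (d + k) (letter false)) (d + k)%N)
        (two_tapes blank (seq_tape (letters (take k.-1 v)) (k%:Z - 2 - j%:Z)%R)).
have L2 : runs (While (scanning Ct) (move_CM MoveL)) (S2 0) (S2 k.-1) (k.-1 * 2).+1.
  apply: runs_while => [j ltj|]; rewrite -[scanning _ _ _]/(isSome (seq_tape _ _ _)); last first.
    by have -> : (k%:Z - 2 - k.-1%:Z = -1)%R by lia.
  split.
    have -> : (k%:Z - 2 - j%:Z = (k - 2 - j)%N%:Z)%R by lia.
    by rewrite seq_tape_read nth_mkseq //; lia.
  act_step; first by apply: move_seq => /=; lia.
  by apply: actM_two_tapes; [exact: keep_tape | apply: move_seq => /=; lia].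
apply: (@runs_leq _ _ _ _ _ _ (1 + (1 + ((k * 2).+1 + (1 + (1 + ((k.-1 * 2).+1 + 1))))))); first by lia.
apply: (@runs_seq _ _ _ _ _ _
  (st (q, (acc, al, false, false, false, false, false))
        tx (seq_tape (letters ys) off.+1) (seq_tape (marks k i) 0%R)
        (seq_tape (nseq d (letter false)) d) (two_tapes blank blank))).
  apply: runs_act; [|exact: keep_tape| |exact: keep_tape|exact: keep_tape|by move=> j; exact: keep_tape].
  - have -> : al = bit_of (seq_tape (letters ys) off 0%R).
      by rewrite seq_tape_read nth_letters //; lia.
    reflexivity.
  - by apply: move_seq => /=; lia.
apply: (@runs_seq _ _ _ _ _ _ (S1 0)).
  rewrite /S1 /= ltn0 !addn0 take0 seq_tape_nil.
  apply: runs_act; [|exact: keep_tape| |exact: keep_tape|exact: keep_tape|by move=> j; exact: keep_tape].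
  - have -> : be = bit_of (seq_tape (letters ys) off.+1 0%R).
      by rewrite seq_tape_read nth_letters //; lia.
    reflexivity.
  - by apply: move_seq => /=; lia.
apply: (runs_seq L1).
apply: (@runs_seq _ _ _ _ _ _
  (st (q, (acc, al, be, false, has id v, has id (drop i.+1 v), true))
        tx (seq_tape (letters ys) (off + k.+2)%N) (seq_tape (marks k i.+1) k.-1)
        (seq_tape (nseq (d + k) (letter false)) (d + k)%N)
        (two_tapes blank (seq_tape (letters v) k.-1)))).
  rewrite /S1 lt addn1 [take k v]take_oversize ?szv // !addnS !addSn.
  act_step; first by apply: move_seq => /=; lia.
  by apply: actM_two_tapes; [exact: keep_tape | apply: move_seq => /=; lia].
apply: (@runs_seq _ _ _ _ _ _ (S2 0)).
  apply: runs_act; [|exact: keep_tape|exact: keep_tape| |exact: keep_tape|].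
  - have -> : last false v = bit_of (seq_tape (letters v) k.-1 0%R).
      by rewrite seq_tape_read nth_letters ?szv ?prednK // -nth_last szv.
    reflexivity.
  - by apply: move_seq => /=; lia.
  - apply: actM_two_tapes; first exact: keep_tape.
    have := put_erase (letter (last false v)) (letters (take k.-1 v)).
    rewrite size_letters szw /letters -map_rcons -wga /ftape_act => ->.
    by rewrite shift_seq_tape; congr seq_tape => /=; lia.
apply: (runs_seq L2).
act_step; first by apply: move_seq => /=; lia.
by apply: actM_two_tapes; [exact: keep_tape | apply: move_seq => /=; lia].
Qed.

Definition move_XM (m : move) : cmd := Act (fun r rd =>
  (r, acts (rd Xt, m) (keep rd Yt) (keep rd Ct) (keep rd Dt) (actM (go m) (go MoveN) rd))).

Definition load_x : cmd :=
  Seq (While (scanning Xt) (Act (fun r rd =>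
         (r, acts (rd Xt, MoveR) (keep rd Yt) (keep rd Ct) (letter false, MoveR)
                  (actM (fun=> (rd Xt, MoveR)) (go MoveN) rd)))))
 (Seq (move_XM MoveL) (Seq (While (scanning Xt) (move_XM MoveL)) (move_XM MoveR))).

Lemma load_x_runs r x ty tc d t1 :
  runs load_x
    (st r (seq_tape (letters x) 0%R) ty tc (seq_tape (nseq d (letter false)) d)
        (two_tapes blank t1))
    (st r (seq_tape (letters x) 0%R) ty tc
        (seq_tape (nseq (d + size x) (letter false)) (d + size x)%N)
        (two_tapes (seq_tape (letters x) 0%R) t1))
    (4 * size x + 4).
Proof.
set n := size x.
pose S1 j := st r (seq_tape (letters x) (Posz j)) ty tc
   (seq_tape (nseq (d + j) (letter false)) (d + j)%N)
   (two_tapes (seq_tape (letters (take j x)) j) t1).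
have L1 : runs (While (scanning Xt) (Act (fun r rd =>
         (r, acts (rd Xt, MoveR) (keep rd Yt) (keep rd Ct) (letter false, MoveR)
                  (actM (fun=> (rd Xt, MoveR)) (go MoveN) rd))))) (S1 0) (S1 n) (n * 2).+1.
  apply: runs_while => [j ltj|]; rewrite -[scanning _ _ _]/(isSome (seq_tape _ _ _)) seq_tape_read; last first.
    by rewrite nth_letters_default.
  split; first by rewrite nth_letters.
  act_step.
  - by apply: move_seq => /=; lia.
  - by rewrite addnS append_counter.
  - apply: actM_two_tapes; last exact: keep_tape.
    by rewrite [store_reads _ _]/= seq_tape_read nth_letters //; apply: append_letter.
pose S2 j := st r (seq_tape (letters x) (n%:Z - 1 - j%:Z)%R) ty tc
   (seq_tape (nseq (d + n) (letter false)) (d + n)%N)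
   (two_tapes (seq_tape (letters x) (n%:Z - 1 - j%:Z)%R) t1).
have L2 : runs (While (scanning Xt) (move_XM MoveL)) (S2 0) (S2 n) (n * 2).+1.
  apply: runs_while => [j ltj|]; rewrite -[scanning _ _ _]/(isSome (seq_tape _ _ _)); last first.
    by have -> : (n%:Z - 1 - n%:Z = -1)%R by lia.
  split.
    have -> : (n%:Z - 1 - j%:Z = (n - 1 - j)%N%:Z)%R by lia.
    by rewrite seq_tape_read nth_letters //; lia.
  act_step; first by apply: move_seq => /=; lia.
  by apply: actM_two_tapes; [apply: move_seq => /=; lia | exact: keep_tape].
have -> : st r (seq_tape (letters x) 0%R) ty tc (seq_tape (nseq d (letter false)) d)
        (two_tapes blank t1) = S1 0.
  by rewrite /S1 addn0 take0 seq_tape_nil.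
apply: (@runs_leq _ _ _ _ _ _ ((n * 2).+1 + (1 + ((n * 2).+1 + 1)))); first by lia.
apply: (runs_seq L1); apply: (runs_seq _ (runs_seq L2 _)).
  rewrite /S1 take_size; act_step; first by apply: move_seq => /=; lia.
  by apply: actM_two_tapes; [apply: move_seq => /=; lia | exact: keep_tape].
act_step; first by apply: move_seq => /=; lia.
by apply: actM_two_tapes; [apply: move_seq => /=; lia | exact: keep_tape].
Qed.

(** * Simulating the given machine and erasing its tapes *)

Definition run_M : cmd :=
  While (fun r _ => ~~ tm_output r.1)
    (Act (fun r rd =>
       let: (q, a) := tm_delta r.1 [ffun j => rd (Mt j)] in
       ((q, r.2), acts (keep rd Xt) (keep rd Yt) (keep rd Ct) (letter false, MoveR) a))).

Definition config_store (cf : config M) fl tx ty tc d : store :=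
  st (cfg_state cf, fl) tx ty tc (seq_tape (nseq d (letter false)) d)
     (fun j => abs_tape (cfg_tapes cf j)).

(** Each simulated step adds one letter to the clock and at most one to the radius of every tape, so
    the clock keeps dominating the cells in use. The number [t] of steps is existential because [M]
    may halt before [T]. *)
Lemma run_M_runs T b (cf : config M) fl tx ty tc d B :
  tm_output (cfg_state (iter T (@tm_step M) cf)) = Some b ->
  (forall j, supported B (abs_tape (cfg_tapes cf j))) ->
  exists (t : nat) (cf' : config M),
    [/\ t <= T, tm_output (cfg_state cf') = Some b,
        forall j, supported (B + t) (abs_tape (cfg_tapes cf' j))
      & runs run_M (config_store cf fl tx ty tc d) (config_store cf' fl tx ty tc (d + t))
             (2 * T + 1)].
Proof.
elim: T cf d B => [|T IH] cf d B out sup.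
  exists 0, cf; split=> //; rewrite ?addn0 //; exists 1 => //.
  by apply: ExecWhileStop; rewrite /= out.
case E: (tm_output (cfg_state cf)) => [b'|].
  (* A halted configuration does not change, so the output after [T.+1] steps is already that of
     [cf]. *)
  have fix_cf : iter T.+1 (@tm_step M) cf = cf.
    by elim: {out} T.+1 => //= m ->; rewrite /tm_step E.
  rewrite fix_cf in out; exists 0, cf; split=> //; rewrite ?addn0 //; exists 1 => //.
  by apply: ExecWhileStop; rewrite /= out.
rewrite iterSr in out.
have sup1 j : supported B.+1 (abs_tape (cfg_tapes (tm_step cf) j)).
  rewrite /tm_step E; case: (tm_delta _ _) => q a; rewrite /= ffunE abs_tape_act.
  exact: supported_act.
have [t [cf' [le out' sup' [m lem ex]]]] := IH (tm_step cf) d.+1 B.+1 out sup1.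
exists t.+1, cf'; split=> //; first by move=> j; rewrite addnS -addSn.
have [m1 le1 ex1] : runs (Act (fun r rd =>
       let: (q, a) := tm_delta r.1 [ffun j => rd (Mt j)] in
       ((q, r.2), acts (keep rd Xt) (keep rd Yt) (keep rd Ct) (letter false, MoveR) a)))
     (config_store cf fl tx ty tc d) (config_store (tm_step cf) fl tx ty tc d.+1) 1.
  rewrite /config_store /tm_step E.
  have -> : [ffun j => tape_read (cfg_tapes cf j)] =
            [ffun j => store_reads (config_store cf fl tx ty tc d) (Mt j)].
    by apply/ffunP => j; rewrite !ffunE -abs_tape_read.
  case D: (tm_delta _ _) => [q a].
  apply: runs_act; [by rewrite D; reflexivity|exact: keep_tape|exact: keep_tape|exact: keep_tape| |].
    exact: append_counter.
  by move=> j; rewrite /= ffunE abs_tape_act.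
exists (m1 + m).+1; first by lia.
apply: ExecWhileLoop ex1 _; first by rewrite /= E.
by rewrite addnS -addSn.
Qed.

Definition block_sign (fl : bool * bool * bool * bool * bool * bool * bool)
    (answer : option bool) : bool :=
  let: (_, al, be, ga, z1, z2, _) := fl in
  if al then (if be then z1 && ~~ z2 else true)
  else if be then false else ~~ (ga && (answer == Some true)).

Definition clean_reg (acc : bool) : reg :=
  (tm_start M, (acc, false, false, false, false, false, false)).

Definition erase_M (m : move) : cmd := Act (fun r rd =>
  (r, acts (keep rd Xt) (keep rd Yt) (keep rd Ct) (rd Dt, m) (fun=> (None, MoveR)))).

(** Walking back over the B letters of the clock takes all heads of [M] B cells to the left. Then
    one erasure, and two more per clock letter on the way forth, make the sweep of 2B+1 cells. The
    clock itself is kept. *)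
Definition finish : cmd :=
  Seq (Act (fun r rd =>
         let: (q, fl) := r in
         (clean_reg (fl.1.1.1.1.1.1 (+) block_sign fl (tm_output q)), only Dt (rd Dt, MoveL) rd)))
 (Seq (While (scanning Dt) (Act (fun r rd =>
         (r, acts (keep rd Xt) (keep rd Yt) (keep rd Ct) (rd Dt, MoveL)
                  (fun j => (rd (Mt j), MoveL))))))
 (Seq (erase_M MoveR)
      (While (scanning Dt) (Seq (erase_M MoveR) (erase_M MoveN))))).

Lemma finish_runs q fl tx ty tc B tm :
  (forall j, supported B (tm j)) ->
  runs finish
    (st (q, fl) tx ty tc (seq_tape (nseq B (letter false)) B) tm)
    (st (clean_reg (fl.1.1.1.1.1.1 (+) block_sign fl (tm_output q))) tx ty tc
        (seq_tape (nseq B (letter false)) B) (two_tapes blank blank))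
    (5 * B + 4).
Proof.
move=> sup; set r := clean_reg _.
pose D (i : int) : ftape A := seq_tape (nseq B (letter false)) i.
pose S1 (i : nat) := st r tx ty tc (D (B%:Z - 1 - i%:Z)%R) (fun j => shift (- i%:Z)%R (tm j)).
have L1 : runs (While (scanning Dt) (Act (fun r rd =>
         (r, acts (keep rd Xt) (keep rd Yt) (keep rd Ct) (rd Dt, MoveL)
                  (fun j => (rd (Mt j), MoveL)))))) (S1 0) (S1 B) (B * 2).+1.
  apply: runs_while => [i lti|]; rewrite -[scanning _ _ _]/(isSome (seq_tape _ _ _)); last first.
    by have -> : (B%:Z - 1 - B%:Z = -1)%R by lia.
  split.
    have -> : (B%:Z - 1 - i%:Z = (B - 1 - i)%N%:Z)%R by lia.
    by rewrite seq_tape_read nth_nseq ifT //; lia.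
  act_step; first by apply: move_seq => /=; lia.
  move=> j; rewrite ftape_act_move shift_shift [displacement _]/=.
  by have -> : (-1 - i%:Z = - i.+1%:Z)%R by lia.
pose S2 (i : nat) := st r tx ty tc (D i)
  (fun j => iter (i.*2).+1 (@erase_right A) (shift (- B%:Z)%R (tm j))).
have L2 : runs (While (scanning Dt) (Seq (erase_M MoveR) (erase_M MoveN)))
            (S2 0) (S2 B) (B * 3).+1.
  apply: runs_while => [i lti|]; rewrite -[scanning _ _ _]/(isSome (seq_tape _ _ _)) seq_tape_read nth_nseq;
    last by rewrite ltnn.
  split; first by rewrite lti.
  apply: (@runs_seq _ _ _ _ _ _ (st r tx ty tc (D i.+1)
    (fun j => iter (i.*2).+2 (@erase_right A) (shift (- B%:Z)%R (tm j)))) _ 1 1).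
    by act_step; first by apply: move_seq => /=; lia.
  by act_step.
have -> : two_tapes blank blank =
          (fun j => iter (B.*2).+1 (@erase_right A) (shift (- B%:Z)%R (tm j))).
  apply: functional_extensionality => j; rewrite erase_supported // /two_tapes.
  by case: ifP => // _; case: ifP.
apply: (@runs_leq _ _ _ _ _ _ (1 + ((B * 2).+1 + (1 + (B * 3).+1)))); first by lia.
apply: (runs_seq _ (runs_seq L1 (runs_seq _ L2))).
  act_step; first by apply: move_seq => /=; lia.
  by move=> j; rewrite oppr0 shift0; exact: keep_tape.
by act_step; first by apply: move_seq => /=; lia.
Qed.

(** * The whole program and its step count *)

Definition process_block : cmd := Seq load_block (Seq load_x (Seq run_M finish)).

Definition product_program : cmd := Seq measure (While (scanning Yt) process_block).

Variables (R : word -> word -> bool) (T : nat -> nat).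
Hypothesis M_decides : tm_decides_in M T R.

(** The clock is never reset: the letters of earlier blocks lengthen the sweep, but their total
    number stays polynomial. *)
Lemma process_block_runs acc x k i ys d (n := size x) (t := T (n + k.-1)) :
  i < k -> size ys = k * k.+2 ->
  exists2 d', d' <= d + (k + n + t)
  & runs process_block
    (st (clean_reg acc) (seq_tape (letters x) 0%R) (seq_tape (letters ys) (i * k.+2)%N)
        (seq_tape (marks k i) 0%R) (seq_tape (nseq d (letter false)) d) (two_tapes blank blank))
    (st (clean_reg (acc (+) negative_block R x i (take k.+2 (drop (i * k.+2) ys))))
        (seq_tape (letters x) 0%R) (seq_tape (letters ys) (i.+1 * k.+2)%N)
        (seq_tape (marks k i.+1) 0%R) (seq_tape (nseq d' (letter false)) d')
        (two_tapes blank blank))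
    (4 * k + 4 * n + 2 * t + 5 * (d + (k + n + t)) + 14).
Proof.
move=> lt sz; set off := i * k.+2.
have le : off + k.+2 <= size ys by rewrite sz /off; nia.
set s := take _ _; pose v := take k (drop off.+2 ys).
have vE : drop 2 s = v by rewrite /s -[X in take X]addn2 -take_drop drop_drop.
have szv : size v = k by rewrite size_takel // size_drop; lia.
pose w := take k.-1 v.
have szw : size w = k.-1 by rewrite size_takel // szv leq_pred.
pose cf := tm_init M x w.
have tapesE : two_tapes (seq_tape (letters x) 0%R) (seq_tape (letters w) 0%R) =
              (fun j => abs_tape (cfg_tapes cf j)).
  apply: functional_extensionality => j; rewrite ffunE abs_tape_of_word /two_tapes.
  by case: ifP => // _; case: ifP => // _; rewrite seq_tape_nil.
(* Loading v and [x] has put k+n letters on the clock, enough to cover the arguments of [M]. *)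
have sup j : supported (k + n) (abs_tape (cfg_tapes cf j)).
  rewrite -[abs_tape _]/((fun j => abs_tape (cfg_tapes cf j)) j) -tapesE /two_tapes.
  case: ifP => _; [|case: ifP => _ //].
    by apply: supported_leq (@supported_seq_tape _ _); rewrite size_letters leq_addl.
  apply: supported_leq (@supported_seq_tape _ _); rewrite size_letters szw; lia.
have out := M_decides x w; rewrite szw -/n -/t in out.
pose fl := (acc, nth false ys off, nth false ys off.+1, last false v,
            has id v, has id (drop i.+1 v), true).
have [t' [cf' [let' out' sup' run']]] :=
  @run_M_runs t _ cf fl (seq_tape (letters x) 0%R) (seq_tape (letters ys) (off + k.+2)%N)
     (seq_tape (marks k i.+1) 0%R) (d + k + n) _ out sup.
exists (d + k + n + t'); first by lia.
have signE : negative_block R x i s = block_sign fl (tm_output (cfg_state cf')).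
  rewrite /negative_block vE szv out' /block_sign /fl /s !nth_take // !nth_drop addn0 addn1.
  by rewrite -/w; case: (R x w).
rewrite signE.
apply: (@runs_leq _ _ _ _ _ _ ((4 * k + 5) + ((4 * n + 4) + ((2 * t + 1) + (5 * (d + k + n + t') + 4)))));
  first by lia.
apply: (runs_seq (load_block_runs _ _ _ _ lt le)).
apply: (runs_seq (load_x_runs _ _ _ _ _ _)).
rewrite -/w tapesE; apply: (runs_seq run').
have -> : i.+1 * k.+2 = off + k.+2 by rewrite mulSn addnC.
apply: finish_runs => j; apply: supported_leq (sup' j); lia.
Qed.

Lemma product_program_runs x y (n := size x) (k := block_count (size y)) (t := T (n + k.-1)) :
  exists2 s,
    runs product_program
      (st (clean_reg false) (seq_tape (letters x) 0%R) (seq_tape (letters y) 0%R)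
          blank blank (two_tapes blank blank)) s
      (k * (4 * k + 7) + 2 * (k * k.+2) + 4 +
       (k * (4 * k + 4 * n + 2 * t + 5 * (k * (k + n + t)) + 15) + 1))
  & s.1 = clean_reg (product_predicate R x y).
Proof.
have [le _] := block_countP (size y); rewrite -/k in le.
pose ys := pad (k * k.+2) y; have sz : size ys = k * k.+2 by rewrite size_pad.
pose acc i := \big[addb/false]_(0 <= l < i)
   negative_block R x l (take k.+2 (drop (l * k.+2) ys)).
(* The clock depends on the actual halting times of [M], so only a bound on its length is
   invariant. *)
pose Inv i (s : store) := exists2 d, d <= i * (k + n + t) &
  s = st (clean_reg (acc i)) (seq_tape (letters x) 0%R) (seq_tape (letters ys) (i * k.+2)%N)
        (seq_tape (marks k i) 0%R) (seq_tape (nseq d (letter false)) d) (two_tapes blank blank).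
have [||/=|s [d _ ->] loop] := @runs_while_inv _ _ _ (scanning Yt) process_block Inv k
   (4 * k + 4 * n + 2 * t + 5 * (k * (k + n + t)) + 14)
   (st (clean_reg false) (seq_tape (letters x) 0%R) (seq_tape (letters ys) 0%R)
       (seq_tape (nseq k (letter false)) 0%R) blank (two_tapes blank blank)).
- move=> i s1 lti [d led ->]; split.
    rewrite -[scanning _ _ _]/(isSome (seq_tape _ _ _)) seq_tape_read nth_letters // sz; nia.
  have [d' led' run'] := process_block_runs (acc i) x d lti sz.
  eexists; last first; first by apply: runs_leq run'; rewrite -/n -/t; nia.
  exists d'; first by apply: leq_trans led' _; rewrite -/n -/t; nia.
  by rewrite /acc big_nat_recr.
- by move=> s1 [d _ ->]; rewrite -[scanning _ _ _]/(isSome (seq_tape _ _ _)) seq_tape_read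
     nth_letters_default // sz.
- exists 0 => //; rewrite /acc big_geq // seq_tape_nil; congr (st _ _ _ (seq_tape _ _) _ _).
  by apply: (@eq_from_nth _ None); rewrite ?size_nseq ?size_mkseq // => l ltl;
     rewrite nth_nseq nth_mkseq ltl.
eexists; first apply: (runs_leq _ (runs_seq (measure_runs _ _ _ _ _) loop)); last by [].
by rewrite -/k -/n -/t; lia.
Qed.

End Machine.

(** * Polynomial running time *)

(** The coefficients are natural numbers, so every term is monotone. *)
Lemma horner_nat_mono (q : {poly nat}) a b : a <= b -> q.[a]%R <= q.[b]%R.
Proof.
move=> le; elim/poly_ind: q => [|q c IH]; first by rewrite !horner0.
by rewrite !hornerMXaddC; apply: leq_add => //; apply: leq_mul.
Qed.

Lemma block_count_leq L : block_count L <= L.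
Proof.
rewrite /block_count; case: ex_minnP => m _; apply.
by rewrite leq_pmulr.
Qed.

Section Encoding.
Variable M : tm.

(** [Xt] and [Yt] come first because [tm_init] writes the arguments on tapes 0 and 1. *)
Definition encode_tape (i : tape_name M) : 'I_((tm_extra M).+4).+2 :=
  match i with
  | Xt => lshift _ (@Ordinal 4 0 isT)
  | Yt => lshift _ (@Ordinal 4 1 isT)
  | Ct => lshift _ (@Ordinal 4 2 isT)
  | Dt => lshift _ (@Ordinal 4 3 isT)
  | Mt j => rshift 4 j
  end.

Definition decode_tape (i : 'I_((tm_extra M).+4).+2) : tape_name M :=
  match split (i : 'I_(4 + (tm_extra M).+2)) with
  | inl a => nth (Xt M) [:: Xt M; Yt M; Ct M; Dt M] a
  | inr j => Mt j
  end.

Lemma encode_tapeK : cancel encode_tape decode_tape.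
Proof.
case=> [||||j]; rewrite /decode_tape.
- by rewrite (unsplitK (inl _ : 'I_4 + 'I_(tm_extra M).+2)).
- by rewrite (unsplitK (inl _ : 'I_4 + 'I_(tm_extra M).+2)).
- by rewrite (unsplitK (inl _ : 'I_4 + 'I_(tm_extra M).+2)).
- by rewrite (unsplitK (inl _ : 'I_4 + 'I_(tm_extra M).+2)).
- by rewrite (unsplitK (inr j : 'I_4 + 'I_(tm_extra M).+2)).
Qed.

End Encoding.

Lemma polytime_product R : polytime R -> polytime (product_predicate R).
Proof.
case=> M [q decM].
exists (compile (@encode_tape M) (@decode_tape M) (clean_reg M false) (product_program M)
   (fun r => r.2.1.1.1.1.1.1)).
pose X : {poly nat} := 'X%R; pose C (c : nat) : {poly nat} := c%:P%R.
(* This is the bound of [product_program_runs] with [k] and [n] both replaced by |x| + |y|, and [t]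
   by [q] at that value. *)
pose Q : {poly nat} := (X * (C 4 * X + C 7) + C 2 * (X * (X + C 2)) + C 4 +
  (X * (C 4 * X + C 4 * X + C 2 * q + C 5 * (X * (X + X + q)) + C 15) + C 1))%R.
have QE s : Q.[s]%R = s * (4 * s + 7) + 2 * (s * (s + 2)) + 4 +
  (s * (4 * s + 4 * s + 2 * q.[s]%R + 5 * (s * (s + s + q.[s]%R)) + 15) + 1).
  by rewrite /Q /X /C !(hornerD, hornerM, hornerX, hornerC).
exists Q; apply: compile_decides; first exact: encode_tapeK.
move=> x y; have [s run sR] := product_program_runs decM x y.
exists s; last by rewrite sR.
set c0 := (c in runs _ c); set c1 := (c in runs _ c _) in run.
have -> : c0 = c1.
  congr pair; apply: functional_extensionality => -[||||j]; rewrite abs_tape_of_word //=.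
  - by rewrite seq_tape_nil.
  - by rewrite seq_tape_nil.
  - by rewrite seq_tape_nil /two_tapes; case: ifP => // _; case: ifP.
apply: runs_leq run; rewrite QE.
set k := block_count _; set S := size x + size y.
have lek : k <= S by apply: leq_trans (block_count_leq _) (leq_addl _ _).
have len : size x <= S by rewrite leq_addr.
have let' : q.[size x + k.-1]%R <= q.[S]%R.
  by apply: horner_nat_mono; rewrite leq_add2l (leq_trans (leq_pred _)) // block_count_leq.
by rewrite -[k.+2]addn2; repeat (apply: leq_add || apply: leq_mul).
Qed.

(** * Summing the signs *)

Local Open Scope ring_scope.

(** Summing over plain words rather than tuples avoids casts when words are cut into blocks. *)
Fixpoint word_sum (n : nat) (F : word -> int) : int :=
  if n is n.+1 then word_sum n (fun w => F (true :: w)) + word_sum n (fun w => F (false :: w))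
  else F [::].

Lemma eq_word_sum n F G : (forall w, size w = n -> F w = G w) -> word_sum n F = word_sum n G.
Proof.
elim: n F G => [|n IH] F G e /=; first exact: e.
by congr (_ + _); apply: IH => w sz; apply: e; rewrite /= sz.
Qed.

Lemma word_sum_tuple n F : \sum_(w : n.-tuple bool) F (val w) = word_sum n F.
Proof.
elim: n F => [|n IH] F /=.
  rewrite (bigD1 [tuple]) //= big1 ?addr0 // => w.
  by rewrite tuple0.
rewrite -!IH.
rewrite (reindex (fun p : bool * n.-tuple bool => [tuple of p.1 :: p.2])) /=; last first.
  exists (fun w : n.+1.-tuple bool => (thead w, [tuple of behead w])) => [[b w] _|w _] /=.
    by congr pair; apply: val_inj.
  by rewrite -tuple_eta.
rewrite -(pair_bigA _ (fun (b : bool) (w : n.-tuple bool) => F (b :: w))) /=.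
by rewrite big_bool.
Qed.

Lemma word_sumD n F G : word_sum n (fun w => F w + G w) = word_sum n F + word_sum n G.
Proof. by elim: n F G => //= n IH F G; rewrite !IH addrACA. Qed.

Lemma word_sumZ n a F : word_sum n (fun w => a * F w) = a * word_sum n F.
Proof. by elim: n F => //= n IH F; rewrite !IH mulrDr. Qed.

Lemma word_sum_const n a : word_sum n (fun=> a) = 2 ^+ n * a.
Proof. by elim: n => [|n IH] /=; rewrite ?mul1r // IH exprS; ring. Qed.

Lemma word_sum_cat m n F :
  word_sum (m + n) F = word_sum m (fun u => word_sum n (fun v => F (u ++ v))).
Proof. by elim: m F => //= m IH F; rewrite !IH. Qed.

(** Distributivity: the blocks of a word of length ks vary independently, so the sum of products is
    the product of sums. *)
Lemma word_sum_blocks k s (G : nat -> word -> int) :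
  word_sum (k * s) (fun y => \prod_(i < k) G i (take s (drop (i * s) y))) =
  \prod_(i < k) word_sum s (G i).
Proof.
elim: k G => [|k IH] G; first by rewrite /= !big_ord0.
rewrite mulSn word_sum_cat big_ord_recl -(IH (fun i => G i.+1)) mulrC -word_sumZ.
apply: eq_word_sum => u szu; rewrite mulrC -word_sumZ.
apply: eq_word_sum => v _; rewrite big_ord_recl /= mul0n drop0 take_size_cat //.
by congr (_ * _); apply: eq_bigr => i _; rewrite /bump /= add1n mulSn addnC -drop_drop drop_size_cat.
Qed.

(** A sign is 1 - 2b; hence the signs sum to zero iff exactly half of the words satisfy [P]. *)
Lemma word_sum_sign n (P : word -> bool) :
  word_sum n (fun w => (-1) ^+ P w) = 2 ^+ n - 2 * word_sum n (fun w => (P w : nat)%:Z).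
Proof.
rewrite -mulNr -[2 ^+ n]mulr1 -word_sum_const -word_sumZ -word_sumD.
by apply: eq_word_sum => w _; case: (P w).
Qed.

Lemma word_sum_zeros n : word_sum n (fun w => (~~ has id w : nat)%:Z) = 1.
Proof.
elim: n => //= n ->.
by rewrite (word_sum_const n 0) mulr0.
Qed.

Lemma word_sum_nonzero_prefix k i : (i < k)%N ->
  word_sum k (fun v => (nonzero_prefix i v : nat)%:Z) = 2 ^+ i.+1 - 1.
Proof.
(* The indicator is that of the words without a 1 beyond position i+1, minus that of the zero
   word. *)
move=> lt; rewrite (eq_word_sum (G := fun v =>
  (~~ has id (drop i.+1 v) : nat)%:Z + -1 * (~~ has id v : nat)%:Z)); last first.
  move=> v _; rewrite /nonzero_prefix; case hv: (has id v); first by case: (has _ _).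
  case hd: (has _ _) => //; move: hv; rewrite -(cat_take_drop i.+1 v) has_cat hd.
  by rewrite orbT.
rewrite word_sumD word_sumZ word_sum_zeros mulr1; congr (_ - 1).
rewrite -(subnKC lt) word_sum_cat -[RHS]mulr1 -word_sum_const.
apply: eq_word_sum => u szu; rewrite -[RHS](word_sum_zeros (k - i.+1)).
by apply: eq_word_sum => v _; rewrite drop_size_cat.
Qed.

Lemma word_sum_last m (P : word -> bool) :
  word_sum m.+1 (fun v => (last false v && P (take m v) : nat)%:Z) =
  word_sum m (fun w => (P w : nat)%:Z).
Proof.
rewrite -addn1 word_sum_cat; apply: eq_word_sum => w sz.
by rewrite /= !last_cat /= addr0 take_size_cat.
Qed.

(** With t = i+1 and N the number of witnesses, the selectors 11, 10, 01, 00 contribute in turn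
    2^(m+1) - 2(2^t - 1), -2^(m+1), 2^(m+1) and 2N - 2^(m+1). *)
Lemma word_sum_negative_block R x m i : (i < m.+1)%N ->
  word_sum m.+3 (fun s => (-1) ^+ negative_block R x i s) =
  2 * (word_sum m (fun w => (R x w : nat)%:Z) - (2 ^+ i.+1 - 1)).
Proof.
move=> lt.
have E : word_sum m.+1 (fun v => (~~ (last false v && R x (take m v)) : nat)%:Z) =
         2 ^+ m.+1 - word_sum m (fun w => (R x w : nat)%:Z).
  rewrite -(word_sum_last m (R x)) -[2 ^+ _]mulr1 -word_sum_const -mulN1r -word_sumZ -word_sumD.
  by apply: eq_word_sum => v _; case: (_ && _).
have split2 k F : word_sum k.+2 F =
    word_sum k (fun v => F [:: true, true & v]) + word_sum k (fun v => F [:: true, false & v]) +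
    (word_sum k (fun v => F [:: false, true & v]) + word_sum k (fun v => F [:: false, false & v])).
  by [].
rewrite split2.
rewrite [X in X + _ + _](_ : _ = 2 ^+ m.+1 - 2 * (2 ^+ i.+1 - 1)); last first.
  by rewrite -(word_sum_nonzero_prefix lt) -word_sum_sign; apply: eq_word_sum => v _;
     rewrite /negative_block /= drop0.
rewrite [X in _ + X + _](_ : _ = - 2 ^+ m.+1); last first.
  by rewrite -[RHS]mulrN1 -word_sum_const; apply: eq_word_sum.
rewrite [X in _ + (X + _)](_ : _ = 2 ^+ m.+1); last first.
  by rewrite -[RHS]mulr1 -word_sum_const; apply: eq_word_sum.
rewrite [X in _ + (_ + X)](_ : _ = 2 ^+ m.+1 -
   2 * (2 ^+ m.+1 - word_sum m (fun w => (R x w : nat)%:Z))); first by ring.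
rewrite -E -word_sum_sign; apply: eq_word_sum => v sz.
by rewrite /negative_block /= drop0 sz.
Qed.

(** * From the sum of signs to the number of witnesses *)

Lemma block_count_exact k : block_count (k * k.+2) = k.
Proof.
rewrite /block_count; case: ex_minnP => j le min; apply/eqP; rewrite eqn_leq min //=.
by rewrite leqNgt; apply/negP => lt; nia.
Qed.

Lemma sign_product_predicate R x y k : size y = (k * k.+2)%N ->
  (-1) ^+ product_predicate R x y =
  \prod_(i < k) (-1) ^+ negative_block R x i (take k.+2 (drop (i * k.+2) y)) :> int.
Proof.
move=> sz; rewrite /product_predicate sz block_count_exact /pad sz subnn cats0 big_mkord.
by apply: (big_morph (fun b : bool => (-1) ^+ b : int) (id1 := 1) (id2 := false) (signr_addb _)).
Qed.

Lemma witness_countE p R x :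
  (witness_count p R x)%:Z = word_sum p.[size x] (fun w => (R x w : nat)%:Z).
Proof.
rewrite -word_sum_tuple /witness_count -sum1dep_card big_mkcond -natz natr_sum.
by apply: eq_bigr => w _; case: (R x w).
Qed.

Lemma witness_count_leq p R x : (witness_count p R x <= 2 ^ p.[size x])%N.
Proof.
by apply: leq_trans (max_card _) _; rewrite card_tuple card_bool.
Qed.

(** As [P] is positive, the exponent P-1 is a natural number, and doubling turns the rational
    equation into one between integers. *)
Lemma half_count_iff (c P : nat) : (0 < P)%N ->
  c%:Q = 2%:Q ^ (P%:Z - 1) <-> 2 ^+ P - 2 * c%:Z = 0 :> int.
Proof.
case: P => // P _; have -> : (P.+1%:Z - 1 = P%:Z) by lia.
rewrite -exprnP exprS -mulrBr.
have -> : 2%:Q ^+ P = (2 ^ P)%N%:Q by rewrite -natrX.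
split=> [/eqP|/eqP]; first by rewrite eqr_int => /eqP ->; rewrite -natz natrX subrr mulr0.
rewrite mulf_eq0 /= subr_eq0 => /eqP e.
by congr (_%:~R); rewrite -e -natz natrX.
Qed.

Theorem theorem8 (L : language) : MNS L -> CeqP L.
Proof.
case=> p [R [polyR LE]].
(* The new witnesses consist of m+1 blocks, each made of two selector bits and m+1 bits of v; this
   is k(k+2) for k = m+1. *)
exists ((p + 1%:P) * (p + 3%:P)), (product_predicate R); split; first exact: polytime_product.
move=> x; set P := _ * _; pose m := p.[size x]; pose N := witness_count p R x.
have PE : P.[size x] = (m.+1 * m.+3)%N.
  by rewrite /P hornerM !hornerD !hornerC -[RHS]/(m.+1 * (3 + m))%N -(addn1 m) (addnC 3).
rewrite half_count_iff ?PE // witness_countE PE -word_sum_sign.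
rewrite (eq_word_sum (G := fun y => \prod_(i < m.+1)
  (-1) ^+ negative_block R x i (take m.+3 (drop (i * m.+3) y)))); last first.
  by move=> y sz; apply: sign_product_predicate.
rewrite (word_sum_blocks _ _ (fun i s => (-1) ^+ negative_block R x i s)) LE -/N.
have factor (i : 'I_m.+1) : word_sum m.+3 (fun s => (-1) ^+ negative_block R x i s) =
    2 * (N%:Z - (2 ^ i.+1 - 1)%N%:Z).
  by rewrite word_sum_negative_block // -witness_countE -/N -subzn ?expn_gt0 //
             -[(2 ^ _)%N%:Z]natz natrX.
split=> [[t [t0 Nt]]|/eqP/prodf_eq0 [i _]].
  (* From 2^t = N + 1 and N at most 2^m follows t at most m+1, with equality when m = 0 and N =
     1. *)
  have lt : (t.-1 < m.+1)%N.
    have := witness_count_leq p R x; rewrite -/N -/m Nt => le.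
    rewrite prednK // -(leq_exp2l (m := 2)) // expnS.
    by have := expn_gt0 2 m; lia.
  apply/eqP/prodf_eq0; exists (Ordinal lt) => //.
  by rewrite factor /= prednK // Nt subrr mulr0.
(* Conversely, a vanishing factor of index [i] gives the exponent i+1, which is positive. *)
rewrite factor mulf_eq0 /= subr_eq0 => /eqP [e].
by exists i.+1.
Qed.
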